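(* Let $0<\phi_0<\phi_1<\frac{\pi}{2}$, let $T^*:=3T(\phi_1)-T_1(\phi_1,\phi_0)$, and let $$T_{C_\ell}(\alpha):=2T(\alpha)-T_1(\alpha,\phi_0)+T_1(\alpha,\phi_1),\qquad \alpha\in\left(\phi_1,\tfrac{\pi}{2}\right).$$ Let $\tilde T_{C_\ell}:(\sin^2\phi_1,1)\to\mathbb{R}$ be the function determined by $\tilde T_{C_\ell}(\sin^2\alpha)=T_{C_\ell}(\alpha)$. Then: (i) $\tilde T_{C_\ell}''(\tilde\alpha)>0$ for all $\tilde\alpha\in(\sin^2\phi_1,1)$, so $\tilde T_{C_\ell}$ is convex; (ii) $\tilde T_{C_\ell}(\tilde\alpha)\to+\infty$ as $\tilde\alpha\to1$, while $\tilde T_{C_\ell}(\tilde\alpha)\to T^*$ and $\tilde T_{C_\ell}'(\tilde\alpha)\to-\infty$ as $\tilde\alpha\downarrow\sin^2\phi_1$; (iii) $T_{C_\ell}$ has exactly one local extremum in $(\phi_1,\frac{\pi}{2})$, and it is a minimum; and $T_{C_\ell}(\alpha)<T^*$ for all $\alpha>\phi_1$ sufficiently close to $\phi_1$.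
   Context: For $\alpha\in(0,\frac{\pi}{2})$ define $T(\alpha):=\int_0^{\alpha}\frac{dx}{\sqrt{\cos 2x-\cos 2\alpha}}$, and for $0<\phi\le\alpha$ define $T_1(\alpha,\phi):=\int_0^{\phi}\frac{dx}{\sqrt{\cos 2x-\cos 2\alpha}}$ (these are convergent, possibly improper, integrals; $T_1(\alpha,\alpha)=T(\alpha)$). *)

(* Defs.v *)
(* Stdlib reals with Coquelicot. *)
From Stdlib Require Export Reals.
From Coquelicot Require Export Coquelicot.

Open Scope R_scope.

Definition integrand (alpha x : R) : R :=
  / sqrt (cos (2 * x) - cos (2 * alpha)).

(* The integrand is singular at [x = alpha], so the integral up to [phi] is the
   limit of the Riemann integrals over [0, t] as [t] increases to [phi].  For
   [0 < phi < alpha] this is the ordinary Riemann integral over [0, phi]. *)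
Definition T1 (alpha phi : R) : R :=
  RInt_gen (integrand alpha) (at_point 0) (at_left phi).

Definition T (alpha : R) : R :=
  RInt_gen (integrand alpha) (at_point 0) (at_left alpha).

Definition Tstar (phi0 phi1 : R) : R := 3 * T phi1 - T1 phi1 phi0.

Definition TC (phi0 phi1 alpha : R) : R :=
  2 * T alpha - T1 alpha phi0 + T1 alpha phi1.

Definition convex_on (a b : R) (f : R -> R) : Prop :=
  forall x y t : R, a < x < b -> a < y < b -> 0 <= t <= 1 ->
    f (t * x + (1 - t) * y) <= t * f x + (1 - t) * f y.

Definition local_min (f : R -> R) (x : R) : Prop :=
  locally x (fun y => f x <= f y).

Definition local_max (f : R -> R) (x : R) : Prop :=
  locally x (fun y => f y <= f x).

Definition local_extremum (f : R -> R) (x : R) : Prop :=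
  local_min f x \/ local_max f x.

(* Main.v *)
Require Import Defs.
From Stdlib Require Import Reals Lra Ranalysis5.
From Coquelicot Require Import Coquelicot.
Open Scope R_scope.

(** Put [s = sin^2 alpha].  Since [cos 2x - cos 2 alpha = 2 (s - sin^2 x)], the
    two incomplete terms combine: [T1 alpha phi1 - T1 alpha phi0] is a proper
    integral over [phi0, phi1].  And the substitution [sin x = sqrt s * sin theta]
    turns [T alpha] into [K(s) / sqrt 2], with [K] the complete elliptic integral
    of the first kind in the parameter [s] ([T_eq]).  Hence, in the variable [s],
    the function of the theorem is
<<
      ( 2 * int_0^(PI/2) (1 - s sin^2 theta)^(-1/2) dtheta
          + int_phi0^phi1 (s - sin^2 x)^(-1/2) dx ) / sqrt 2
>>
    on [sin^2 phi1 < s < 1] ([TC_eq_period]).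

    Both integrands have the form [(p + q s)^(-1/2)], whose second derivative in
    [s] is [3/4 q^2 (p + q s)^(-5/2) > 0].  Differentiating under the integral
    sign ([is_derive_root_integral]) gives the convexity.

    Both divergences follow from one logarithmic comparison,
    [RInt_log_lower]: near [theta = PI/2] the first integrand is at least
    [1 / (sqrt (1 - s) + (PI/2 - theta))], and near [x = phi1] the derivative
    in [s] of the second integrand is at most
    [- (1/2) / ((s - sin^2 phi1) + (phi1 - x))].  For the finite limit at
    [sin^2 phi1], the same substitution writes the integral over [0, phi1] as an
    incomplete elliptic integral up to [asin (sin phi1 / sqrt s)], an amplitude
    that tends to [PI/2]; so this integral tends to [K (sin^2 phi1)], which
    supplies the third [T phi1] in [Tstar].

    A strictly convex function whose slope tends to minus infinity at the left
    end and whose values tend to plus infinity at the right end has exactly one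
    critical point ([valley_point]); the increasing change of variable
    [s = sin^2 alpha] carries it back to [TC]. *)

(** * Integrals of inverse square roots of affine functions of a parameter *)

(** The [n]-th derivative in [s] of [(p x + q x * s)^(-1/2)], up to a constant
    factor: this is [q^n (p + q s)^(-1/2 - n)].  Both integrals that occur are
    instances, so that each is differentiated by the same lemma. *)
Definition root_kernel (p q : R -> R) (n : nat) (s x : R) : R :=
  q x ^ n / (sqrt (p x + q x * s) * (p x + q x * s) ^ n).

Definition root_integral (p q : R -> R) (a b : R) (n : nat) (s : R) : R :=
  RInt (root_kernel p q n s) a b.

Lemma is_derive_root_kernel p q n s x :
  0 < p x + q x * s ->
  is_derive (fun u => root_kernel p q n u x) s
    (- (1 / 2 + INR n) * root_kernel p q (S n) s x).
Proof.
  intros Hpos. unfold root_kernel.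
  assert (Hs := sqrt_lt_R0 _ Hpos).
  assert (Hn := pow_lt _ n Hpos).
  auto_derive.
  - repeat split; auto. apply Rgt_not_eq. now apply Rmult_lt_0_compat.
  - set (u := p x + q x * s) in *.
    assert (Hd : q x * 1 * (INR n * u ^ pred n) = q x * INR n * u ^ n / u).
    { destruct n as [|m]; [simpl|simpl pred; simpl pow]; field; lra. }
    rewrite Hd.
    simpl pow.
    (* After eliminating [u] in favour of its root, the identity is rational. *)
    assert (Hu : u = sqrt u * sqrt u) by (rewrite sqrt_sqrt; lra).
    set (r := sqrt u) in *. set (w := u ^ n) in *. rewrite Hu.
    field. lra.
Qed.

Lemma continuity_2d_snd (f : R -> R) s x :
  continuity_pt f x -> continuity_2d_pt (fun _ v => f v) s x.
Proof.
  intros Hf. apply (continuity_1d_2d_pt_comp f (fun _ v => v)); [exact Hf|].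
  apply continuity_2d_pt_id2.
Qed.

Lemma continuity_2d_affine p q s x :
  continuity_pt p x -> continuity_pt q x ->
  continuity_2d_pt (fun u v => p v + q v * u) s x.
Proof.
  intros Hp Hq. apply continuity_2d_pt_plus; [now apply continuity_2d_snd|].
  apply continuity_2d_pt_mult; [now apply continuity_2d_snd | apply continuity_2d_pt_id1].
Qed.

Lemma continuity_2d_root_kernel p q n s x :
  continuity_pt p x -> continuity_pt q x -> 0 < p x + q x * s ->
  continuity_2d_pt (root_kernel p q n) s x.
Proof.
  intros Hp Hq Hpos. unfold root_kernel.
  assert (Hq2 := continuity_2d_snd q s x Hq).
  assert (Hu := continuity_2d_affine p q s x Hp Hq).
  assert (Hpow : forall f, continuity_2d_pt f s x ->
            continuity_2d_pt (fun u v => f u v ^ n) s x).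
  { intros f Hf. apply (continuity_1d_2d_pt_comp (fun y => y ^ n) f); [|exact Hf].
    apply derivable_continuous_pt, derivable_pt_pow. }
  apply continuity_2d_pt_mult; [now apply Hpow|].
  apply continuity_2d_pt_inv.
  - apply continuity_2d_pt_mult; [|now apply Hpow].
    apply (continuity_1d_2d_pt_comp sqrt); [|exact Hu].
    apply continuity_pt_sqrt. lra.
  - apply Rgt_not_eq, Rmult_lt_0_compat; [now apply sqrt_lt_R0 | now apply pow_lt].
Qed.

Lemma continuous_root_kernel p q n s x :
  continuity_pt p x -> continuity_pt q x -> 0 < p x + q x * s ->
  continuous (root_kernel p q n s) x.
Proof.
  intros Hp Hq Hpos. apply continuity_pt_filterlim.
  intros eps Heps.
  destruct (continuity_2d_root_kernel p q n s x Hp Hq Hpos (mkposreal eps Heps))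
    as [d Hd].
  exists d. split; [apply d|]. intros y [_ Hy].
  apply Hd; [|exact Hy].
  rewrite Rminus_diag, Rabs_R0. apply d.
Qed.

Lemma ex_RInt_root_kernel p q a b n s :
  a <= b -> continuity p -> continuity q ->
  (forall x, a <= x <= b -> 0 < p x + q x * s) ->
  ex_RInt (root_kernel p q n s) a b.
Proof.
  intros Hab Hp Hq Hpos. apply (ex_RInt_continuous (V := R_CompleteNormedModule)).
  rewrite Rmin_left, Rmax_right by assumption.
  intros x Hx. apply continuous_root_kernel; auto.
Qed.

(** Positivity is required near [s] and not only at [s], because the derivative
    under the integral sign must exist for all nearby parameters. *)
Lemma is_derive_root_integral p q a b n s :
  a <= b -> continuity p -> continuity q ->
  locally s (fun u => forall x, a <= x <= b -> 0 < p x + q x * u) ->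
  is_derive (root_integral p q a b n) s
    (- (1 / 2 + INR n) * root_integral p q a b (S n) s).
Proof.
  intros Hab Hp Hq Hpos. unfold root_integral.
  assert (Hs := locally_singleton _ _ Hpos). 
  replace (- (1 / 2 + INR n) * RInt (root_kernel p q (S n) s) a b)
    with (RInt (fun t => Derive (fun u => root_kernel p q n u t) s) a b).
  - apply is_derive_RInt_param.
    + apply filter_imp with (2 := Hpos). rewrite Rmin_left, Rmax_right by assumption.
      intros u Hu t Ht. eexists. apply is_derive_root_kernel. now apply Hu.
    + rewrite Rmin_left, Rmax_right by assumption. intros t Ht.
      apply continuity_2d_pt_ext_loc
        with (fun u v => - (1 / 2 + INR n) * root_kernel p q (S n) u v).
      * assert (Hu := continuity_2d_affine p q s t (Hp t) (Hq t)).
        destruct (Hu (mkposreal _ (Hs t Ht))) as [d Hd]. exists d.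
        intros u v Huu Hvv. symmetry. apply is_derive_unique, is_derive_root_kernel.
        specialize (Hd u v Huu Hvv). simpl in Hd. apply Rabs_def2 in Hd. lra.
      * apply continuity_2d_pt_mult; [apply continuity_2d_pt_const|].
        apply continuity_2d_root_kernel; auto.
    + apply filter_imp with (2 := Hpos). intros u Hu.
      now apply ex_RInt_root_kernel.
  - rewrite <- (RInt_scal (V := R_CompleteNormedModule) (root_kernel p q (S n) s)).
    + apply RInt_ext. rewrite Rmin_left, Rmax_right by assumption. intros x Hx.
      apply is_derive_unique, is_derive_root_kernel, Hs. lra.
    + apply ex_RInt_root_kernel; auto.
Qed.

(** * Limits along arbitrary filters *)

Lemma filterlim_Rplus {U : Type} (F : (U -> Prop) -> Prop) {FF : Filter F}
  (f g : U -> R) (a b : R) :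
  filterlim f F (locally a) -> filterlim g F (locally b) ->
  filterlim (fun u => f u + g u) F (locally (a + b)).
Proof.
  intros Hf Hg. apply (filterlim_comp_2 f g Rplus Hf Hg).
  exact (filterlim_plus (V := R_NormedModule) a b).
Qed.

Lemma filterlim_Rmult {U : Type} (F : (U -> Prop) -> Prop) {FF : Filter F}
  (f g : U -> R) (a b : R) :
  filterlim f F (locally a) -> filterlim g F (locally b) ->
  filterlim (fun u => f u * g u) F (locally (a * b)).
Proof.
  intros Hf Hg. apply (filterlim_comp_2 f g Rmult Hf Hg).
  exact (filterlim_mult (K := R_AbsRing) a b).
Qed.

Lemma continuous_within (f : R -> R) (D : R -> Prop) (x : R) :
  continuous f x -> filterlim f (within D (locally x)) (locally (f x)).
Proof. intros Hf P HP. apply filter_le_within. exact (Hf P HP). Qed.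

(** * Elliptic integrals *)

Definition const1 (_ : R) : R := 1.
Definition opp_sin2 (x : R) : R := - sin x ^ 2.

Lemma continuity_const1 : continuity const1.
Proof. apply continuity_const. now intros x y. Qed.

Lemma continuity_opp_sin2 : continuity opp_sin2.
Proof.
  intros x. apply continuity_pt_filterlim.
  apply (ex_derive_continuous (V := R_NormedModule)).
  unfold opp_sin2. auto_derive. exact I.
Qed.

(** The incomplete elliptic integral of the first kind with amplitude [y], in
    the parameter [s = k^2]. *)
Definition elliptic (s y : R) : R := root_integral const1 opp_sin2 0 y 0 s.

Lemma sin2_le_1 x : 0 <= sin x ^ 2 <= 1.
Proof. generalize (SIN_bound x). nra. Qed.

Lemma elliptic_radicand_ge s x : 0 <= s < 1 -> 1 - s <= const1 x + opp_sin2 x * s.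
Proof. unfold const1, opp_sin2. generalize (sin2_le_1 x). nra. Qed.

Lemma sin2_lt a b : 0 <= a -> a < b -> b <= PI / 2 -> sin a ^ 2 < sin b ^ 2.
Proof.
  intros Ha Hab Hb.
  assert (0 <= sin a) by (apply sin_ge_0; lra).
  assert (sin a < sin b) by (apply sin_increasing_1; lra).
  nra.
Qed.

Lemma sin2_le a b : 0 <= a -> a <= b -> b <= PI / 2 -> sin a ^ 2 <= sin b ^ 2.
Proof.
  intros Ha [Hab| ->] Hb; [|lra]. apply Rlt_le. now apply sin2_lt.
Qed.

Lemma incomplete_radicand_gt_0 s t x :
  0 <= x <= t -> t <= PI / 2 -> sin t ^ 2 < s -> 0 < opp_sin2 x + const1 x * s.
Proof.
  intros Hx Ht Hs. unfold const1, opp_sin2.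
  generalize (sin2_le x t (proj1 Hx) (proj2 Hx) Ht). lra.
Qed.

Lemma is_derive_asin x : -1 < x < 1 -> is_derive asin x (/ sqrt (1 - x ^ 2)).
Proof.
  intros Hx. replace (/ sqrt (1 - x ^ 2)) with (derive_pt asin x (derivable_pt_asin x Hx)).
  - apply is_derive_Reals. apply derive_pt_eq_1 with (derivable_pt_asin x Hx). reflexivity.
  - rewrite derive_pt_asin. unfold Rdiv. rewrite Rmult_1_l.
    now replace (x ^ 2) with (Rsqr x) by (unfold Rsqr; ring).
Qed.

(** The substitution [sin x = sqrt s * sin theta], read from [x] to
    [theta = asin (sin x / sqrt s)]: the elliptic integrand at [theta] is
    [1 / cos x], and [cos x] cancels against the derivative of [theta]. *)
Lemma incomplete_eq_elliptic s t :
  0 <= t < PI / 2 -> sin t ^ 2 < s < 1 ->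
  root_integral opp_sin2 const1 0 t 0 s = elliptic s (asin (sin t / sqrt s)).
Proof.
  intros Ht Hs.
  assert (Hs0 : 0 < s) by (generalize (sin2_le_1 t); lra).
  assert (Hr := sqrt_lt_R0 s Hs0).
  assert (Hrr : sqrt s * sqrt s = s) by (apply sqrt_sqrt; lra).
  assert (Hx : forall x, 0 <= x <= t -> 0 <= sin x / sqrt s < 1 /\ 0 < cos x /\ sin x ^ 2 < s).
  { intros x Hx. assert (0 <= sin x) by (apply sin_ge_0; lra).
    assert (Hx2 := sin2_le x t (proj1 Hx) (proj2 Hx) (Rlt_le _ _ (proj2 Ht))).
    repeat split.
    - apply Rdiv_le_0_compat; assumption.
    - apply Rlt_div_l; [assumption|]. nra.
    - apply cos_gt_0; lra.
    - lra. }
  unfold elliptic, root_integral.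
  replace 0 with (asin (sin 0 / sqrt s)) at 2.
  2:{ rewrite sin_0. unfold Rdiv. rewrite Rmult_0_l. apply asin_0. }
  rewrite <- (RInt_comp (root_kernel const1 opp_sin2 0 s) (fun x => asin (sin x / sqrt s))
            (fun x => cos x / sqrt s * / sqrt (1 - (sin x / sqrt s) ^ 2))).
  - apply RInt_ext. rewrite Rmin_left, Rmax_right by lra. intros x Hx0.
    destruct (Hx x) as [[Hx1 Hx2] [Hx3 Hx4]]; [lra|].
    unfold scal; simpl; unfold mult; simpl. unfold root_kernel; simpl pow.
    unfold opp_sin2, const1. rewrite sin_asin by lra.
    replace (1 + - (sin x / sqrt s) ^ 2 * s) with (cos x * cos x).
    2:{ generalize (sin2_cos2 x). unfold Rsqr. intros E.
        transitivity (1 - sin x * sin x); [lra|].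
        set (r := sqrt s) in *. rewrite <- Hrr. field. lra. }
    rewrite sqrt_square by lra.
    replace (- sin x ^ 2 + 1 * s) with (s * (1 - (sin x / sqrt s) ^ 2)).
    2:{ set (r := sqrt s) in *. rewrite <- Hrr. field. lra. }
    assert (Hp : 0 < 1 - (sin x / sqrt s) ^ 2) by nra.
    rewrite sqrt_mult by lra.
    assert (Hq := sqrt_lt_R0 _ Hp).
    change (sin x / sqrt s * (sin x / sqrt s * 1)) with ((sin x / sqrt s) ^ 2).
    set (r := sqrt (1 - (sin x / sqrt s) ^ 2)) in *.
    field. lra.
  - intros x _. apply continuous_root_kernel.
    + apply continuity_const1.
    + apply continuity_opp_sin2.
    + generalize (elliptic_radicand_ge s (asin (sin x / sqrt s))). lra.
  - rewrite Rmin_left, Rmax_right by lra. intros x Hx0.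
    destruct (Hx x) as [[Hx1 Hx2] [Hx3 Hx4]]; [lra|].
    assert (Hp : 0 < 1 - (sin x / sqrt s) ^ 2) by nra.
    assert (Hq := sqrt_lt_R0 _ Hp).
    split.
    + apply (is_derive_comp asin (fun x => sin x / sqrt s)).
      * apply is_derive_asin. lra.
      * auto_derive; [lra|]. field. lra.
    + apply (ex_derive_continuous (V := R_NormedModule)).
      auto_derive.
      replace (1 + - (sin x * / sqrt s * (sin x * / sqrt s * 1)))
        with (1 - (sin x / sqrt s) ^ 2) by (unfold Rdiv; ring).
      repeat split; lra.
Qed.

(** The missing part of the complete integral has length [PI / 2 - y], and its
    integrand is at most [1 / sqrt (1 - s)].  The bound is uniform for [s] away
    from 1, which gives joint continuity at the amplitude [PI / 2]. *)
Lemma elliptic_bounds s y :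
  0 <= s < 1 -> 0 <= y <= PI / 2 ->
  elliptic s (PI / 2) - (PI / 2 - y) / sqrt (1 - s) <= elliptic s y <= elliptic s (PI / 2).
Proof.
  intros Hs Hy.
  assert (Hpos : forall x, 0 < const1 x + opp_sin2 x * s).
  { intros x. generalize (elliptic_radicand_ge s x Hs). lra. }
  assert (Hex : forall a b, a <= b -> ex_RInt (root_kernel const1 opp_sin2 0 s) a b).
  { intros a b Hab. apply ex_RInt_root_kernel; auto using continuity_const1, continuity_opp_sin2. }
  assert (HC : elliptic s y + RInt (root_kernel const1 opp_sin2 0 s) y (PI / 2)
               = elliptic s (PI / 2)).
  { apply (RInt_Chasles (V := R_CompleteNormedModule)); apply Hex; lra. }
  assert (Hr : 0 < sqrt (1 - s)) by (apply sqrt_lt_R0; lra).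
  assert (Hb : forall x, 0 <= root_kernel const1 opp_sin2 0 s x <= / sqrt (1 - s)).
  { intros x. unfold root_kernel. simpl pow. rewrite Rmult_1_r. unfold Rdiv. rewrite Rmult_1_l.
    split.
    - apply Rlt_le, Rinv_0_lt_compat, sqrt_lt_R0, Hpos.
    - apply Rinv_le_contravar; [assumption|]. apply sqrt_le_1_alt. now apply elliptic_radicand_ge. }
  assert (H0 : 0 <= RInt (root_kernel const1 opp_sin2 0 s) y (PI / 2)).
  { apply RInt_ge_0; [lra| apply Hex; lra | intros; apply Hb]. }
  assert (H1 : RInt (root_kernel const1 opp_sin2 0 s) y (PI / 2) <= (PI / 2 - y) / sqrt (1 - s)).
  { transitivity (RInt (fun _ => / sqrt (1 - s)) y (PI / 2)).
    - apply RInt_le; [lra | apply Hex; lra | apply ex_RInt_const | intros; apply Hb].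
    - rewrite RInt_const. unfold scal; simpl; unfold mult; simpl. apply Req_le. reflexivity. }
  lra.
Qed.

Lemma continuous_complete_elliptic s :
  0 < s < 1 -> continuous (fun u => elliptic u (PI / 2)) s.
Proof.
  intros Hs. apply (ex_derive_continuous (V := R_NormedModule)). eexists.
  unfold elliptic. apply is_derive_root_integral.
  - generalize PI2_1; lra.
  - apply continuity_const1.
  - apply continuity_opp_sin2.
  - generalize (open_and _ _ (open_gt 0) (open_lt 1) s (conj (proj1 Hs) (proj2 Hs))).
    apply filter_imp. intros u Hu x _. generalize (elliptic_radicand_ge u x). lra.
Qed.

Lemma filterlim_elliptic {U : Type} (F : (U -> Prop) -> Prop) {FF : Filter F}
  (S Y : U -> R) (s : R) :
  0 < s < 1 -> filterlim S F (locally s) -> filterlim Y F (locally (PI / 2)) ->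
  F (fun u => 0 <= Y u <= PI / 2) ->
  filterlim (fun u => elliptic (S u) (Y u)) F (locally (elliptic s (PI / 2))).
Proof.
  intros Hs HS HY Hb.
  assert (HK : filterlim (fun u => elliptic (S u) (PI / 2)) F (locally (elliptic s (PI / 2)))).
  { apply filterlim_comp with (1 := HS). now apply continuous_complete_elliptic. }
  apply filterlim_le_le with
    (f := fun u => elliptic (S u) (PI / 2) - (PI / 2 - Y u) / sqrt (1 - S u))
    (h := fun u => elliptic (S u) (PI / 2)) (l := Finite (elliptic s (PI / 2))).
  - assert (HS' : F (fun u => 0 < S u < 1)).
    { exact (HS (fun v => 0 < v < 1) (open_and _ _ (open_gt 0) (open_lt 1) s Hs)). }
    generalize (filter_and _ _ Hb HS'). apply filter_imp. intros u [Hu1 Hu2].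
    apply elliptic_bounds; lra.
  - simpl.
    replace (elliptic s (PI / 2))
      with (elliptic s (PI / 2) + (PI / 2 + - 1 * (PI / 2)) * - / sqrt (1 - s)) by ring.
    apply filterlim_ext with (fun u => elliptic (S u) (PI / 2)
      + (PI / 2 + - 1 * Y u) * - / sqrt (1 - S u)).
    { intros u. unfold Rdiv. ring. }
    apply (filterlim_Rplus F); [exact HK|]. apply (filterlim_Rmult F).
    + apply (filterlim_Rplus F); [apply filterlim_const|].
      apply (filterlim_Rmult F); [apply filterlim_const | exact HY].
    + apply (filterlim_comp U R R S (fun u => - / sqrt (1 - u)) F (locally s)); [exact HS|].
      apply (ex_derive_continuous (V := R_NormedModule) (fun u => - / sqrt (1 - u))).
      auto_derive. assert (0 < sqrt (1 - s)) by (apply sqrt_lt_R0; lra).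
      replace (1 + - s) with (1 - s) by ring. repeat split; lra.
  - exact HK.
Qed.

(** One-sided continuity at the end of the domain, where [asin] is not
    differentiable; it follows from the monotonicity of [sin]. *)
Lemma filterlim_asin_1 : filterlim asin (at_left 1) (locally (PI / 2)).
Proof.
  apply filterlim_locally. intros eps.
  assert (HPI := PI_RGT_0).
  set (e := Rmin eps (PI / 2)).
  assert (He : 0 < e) by (apply Rmin_pos; [apply eps | lra]).
  assert (He1 : e <= eps) by apply Rmin_l.
  assert (He2 : e <= PI / 2) by apply Rmin_r.
  assert (Hd : sin (PI / 2 - e) < 1).
  { rewrite <- sin_PI2. apply sin_increasing_1; lra. }
  assert (Hd0 : 0 <= sin (PI / 2 - e)) by (apply sin_ge_0; lra).
  assert (Hd' : 0 < 1 - sin (PI / 2 - e)) by lra.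
  exists (mkposreal _ Hd'). intros y Hy Hy1.
  apply Rabs_def2 in Hy. unfold minus, plus, opp in Hy; simpl in Hy.
  assert (Hb := asin_bound y).
  assert (Hlt : PI / 2 - e < asin y).
  { apply sin_increasing_0; try lra. rewrite sin_asin; lra. }
  apply Rabs_def1; unfold minus, plus, opp; simpl; lra.
Qed.

(** This one limit serves twice: with [S] constant it evaluates the improper
    integral [T alpha], and with [S] tending to [sin^2 phi1] it gives the limit
    of the integral over [0, phi1]. *)
Lemma filterlim_elliptic_asin {U : Type} (F : (U -> Prop) -> Prop) {FF : Filter F}
  (S Y : U -> R) (s : R) :
  0 < s < 1 -> filterlim S F (locally s) -> filterlim Y F (locally 1) ->
  F (fun u => 0 < Y u < 1) ->
  filterlim (fun u => elliptic (S u) (asin (Y u))) F (locally (elliptic s (PI / 2))).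
Proof.
  intros Hs HS HY Hb. apply (filterlim_elliptic F); [exact Hs | exact HS | |].
  - apply (filterlim_comp U R R Y asin F (at_left 1)); [|apply filterlim_asin_1].
    intros P HP. change (F (fun u => P (Y u))).
    assert (HYP : F (fun u => Y u < 1 -> P (Y u))) by exact (HY _ HP).
    generalize (filter_and _ _ HYP Hb). apply filter_imp.
    intros u [Hu1 Hu2]. exact (Hu1 (proj2 Hu2)).
  - apply filter_imp with (2 := Hb). intros u Hu.
    assert (Hba := asin_bound (Y u)). split; [|lra].
    apply Rnot_lt_le. intros Hlt.
    assert (sin (asin (Y u)) < 0) by (apply sin_lt_0_var; lra).
    rewrite sin_asin in H; lra.
Qed.

(** * The periods as elliptic integrals *)

Lemma RInt_gen_at_left (f : R -> R) (a b l : R) :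
  at_left b (fun t => ex_RInt f a t) ->
  filterlim (RInt f a) (at_left b) (locally l) ->
  RInt_gen f (at_point a) (at_left b) = l.
Proof.
  intros Hex Hlim. apply (is_RInt_gen_unique (V := R_CompleteNormedModule)).
  intros P HP. 
  exists (fun x => x = a) (fun t => ex_RInt f a t /\ P (RInt f a t)).
  - reflexivity.
  - apply filter_and; [exact Hex | exact (Hlim P HP)].
  - intros x t -> [Ht HPt]. exists (RInt f a t). split; [|exact HPt].
    now apply (RInt_correct (V := R_CompleteNormedModule)).
Qed.

Lemma integrand_eq alpha x :
  integrand alpha x = / sqrt 2 * root_kernel opp_sin2 const1 0 (sin alpha ^ 2) x.
Proof.
  unfold integrand, root_kernel. rewrite !cos_2a_sin. simpl pow.
  unfold opp_sin2, const1.
  replace (1 - 2 * sin x * sin x - (1 - 2 * sin alpha * sin alpha))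
    with (2 * (- sin x ^ 2 + 1 * (sin alpha * (sin alpha * 1)))) by ring.
  rewrite sqrt_mult_alt by lra. rewrite Rinv_mult. unfold Rdiv.
  now rewrite (Rmult_1_l (/ _)), (Rmult_1_r (sqrt _)).
Qed.

Lemma is_RInt_integrand alpha t :
  0 <= t < alpha -> alpha <= PI / 2 ->
  is_RInt (integrand alpha) 0 t
    (/ sqrt 2 * root_integral opp_sin2 const1 0 t 0 (sin alpha ^ 2)).
Proof.
  intros Ht Ha.
  apply is_RInt_ext with (fun x => scal (/ sqrt 2) (root_kernel opp_sin2 const1 0 (sin alpha ^ 2) x)).
  { intros x _. symmetry. apply integrand_eq. }
  apply (is_RInt_scal (V := R_NormedModule)).
  apply (RInt_correct (V := R_CompleteNormedModule)).
  apply ex_RInt_root_kernel; auto using continuity_const1, continuity_opp_sin2; [lra|].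
  intros x Hx. apply incomplete_radicand_gt_0 with t; [lra|lra|]. apply sin2_lt; lra.
Qed.

Lemma at_left_interval a b : a < b -> at_left b (fun t => a < t < b).
Proof.
  intros Hab. unfold at_left, within.
  apply filter_imp with (2 := open_gt a b Hab). auto.
Qed.

Lemma at_right_interval a b : a < b -> at_right a (fun t => a < t < b).
Proof.
  intros Hab. unfold at_right, within.
  apply filter_imp with (2 := open_lt b a Hab). auto.
Qed.

Lemma T1_eq alpha phi :
  0 < phi < alpha -> alpha <= PI / 2 ->
  T1 alpha phi = / sqrt 2 * root_integral opp_sin2 const1 0 phi 0 (sin alpha ^ 2).
Proof.
  intros Hphi Ha.
  assert (HR : forall t, 0 <= t < alpha -> is_RInt (integrand alpha) 0 t (RInt (integrand alpha) 0 t)).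
  { intros t Ht. apply (RInt_correct (V := R_CompleteNormedModule)).
    eexists. now apply is_RInt_integrand. }
  rewrite <- (is_RInt_unique _ _ _ _ (is_RInt_integrand alpha phi ltac:(lra) Ha)).
  apply (RInt_gen_at_left (integrand alpha) 0 phi).
  - apply filter_imp with (2 := at_left_interval 0 phi (proj1 Hphi)).
    intros t Ht. eexists. apply HR. lra.
  - apply continuous_within. apply (continuous_RInt_1 (integrand alpha) 0).
    apply filter_imp with (2 := open_and _ _ (open_gt 0) (open_lt alpha) phi Hphi).
    intros t Ht. apply HR. lra.
Qed.

Lemma T_eq alpha :
  0 < alpha < PI / 2 -> T alpha = / sqrt 2 * elliptic (sin alpha ^ 2) (PI / 2).
Proof.
  intros Ha.
  assert (Hs : 0 < sin alpha) by (apply sin_gt_0; lra).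
  assert (Hs1 : sin alpha < 1).
  { rewrite <- sin_PI2. apply sin_increasing_1; lra. }
  assert (Hnear := at_left_interval 0 alpha (proj1 Ha)).
  assert (Hquot : at_left alpha (fun t => 0 < sin t / sin alpha < 1)).
  { apply filter_imp with (2 := Hnear). intros t Ht. split.
    - apply Rdiv_lt_0_compat; [apply sin_gt_0; lra | assumption].
    - apply Rlt_div_l; [assumption|]. rewrite Rmult_1_l. apply sin_increasing_1; lra. }
  apply (RInt_gen_at_left (integrand alpha) 0 alpha).
  - apply filter_imp with (2 := Hnear). intros t Ht. eexists.
    apply is_RInt_integrand; lra.
  - apply filterlim_ext_loc with
      (fun t => / sqrt 2 * elliptic (sin alpha ^ 2) (asin (sin t / sin alpha))).
    { apply filter_imp with (2 := Hnear). intros t Ht. symmetry.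
      rewrite (is_RInt_unique _ _ _ _ (is_RInt_integrand alpha t ltac:(lra) ltac:(lra))).
      rewrite incomplete_eq_elliptic.
      - now rewrite sqrt_pow2 by lra.
      - lra.
      - split; [apply sin2_lt; lra | nra]. }
    apply (filterlim_Rmult (at_left alpha)); [apply filterlim_const|].
    apply (filterlim_elliptic_asin (at_left alpha) (fun _ => sin alpha ^ 2)
             (fun t => sin t / sin alpha)).
    + split; nra.
    + apply filterlim_const.
    + replace 1 with (sin alpha / sin alpha) by (field; lra).
      apply (continuous_within (fun t => sin t / sin alpha)).
      apply (ex_derive_continuous (V := R_NormedModule) (fun t => sin t / sin alpha)).
      auto_derive. lra.
    + exact Hquot.
Qed.

(** * The function of the theorem in the variable [sin^2 alpha] *)

(** For [n = 0] this is the function itself; a general [n] gives its [n]-th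
    derivative up to a constant factor. *)
Definition period (phi0 phi1 : R) (n : nat) (s : R) : R :=
  / sqrt 2 * (2 * root_integral const1 opp_sin2 0 (PI / 2) n s
              + root_integral opp_sin2 const1 phi0 phi1 n s).

Lemma locally_between (a b x : R) : a < x < b -> locally x (fun y => a < y < b).
Proof. intros Hx. exact (open_and _ _ (open_gt a) (open_lt b) x Hx). Qed.

Lemma incomplete_Chasles phi0 phi1 n s :
  0 <= phi0 <= phi1 -> phi1 <= PI / 2 -> sin phi1 ^ 2 < s ->
  root_integral opp_sin2 const1 0 phi0 n s + root_integral opp_sin2 const1 phi0 phi1 n s
  = root_integral opp_sin2 const1 0 phi1 n s.
Proof.
  intros H0 H1 Hs. apply (RInt_Chasles (V := R_CompleteNormedModule));
    apply ex_RInt_root_kernel; auto using continuity_const1, continuity_opp_sin2;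
    try lra; intros x Hx; apply incomplete_radicand_gt_0 with phi1; lra.
Qed.

Lemma TC_eq_period phi0 phi1 alpha :
  0 < phi0 < phi1 -> phi1 < alpha < PI / 2 ->
  TC phi0 phi1 alpha = period phi0 phi1 0 (sin alpha ^ 2).
Proof.
  intros Hphi Ha. unfold TC, period.
  rewrite T_eq, !T1_eq by lra.
  rewrite <- (incomplete_Chasles phi0 phi1) by (try apply sin2_lt; lra).
  unfold elliptic. ring.
Qed.

Lemma is_derive_period phi0 phi1 n s :
  0 <= phi0 <= phi1 -> phi1 < PI / 2 -> sin phi1 ^ 2 < s < 1 ->
  is_derive (period phi0 phi1 n) s (- (1 / 2 + INR n) * period phi0 phi1 (S n) s).
Proof.
  intros H0 H1 Hs.
  assert (Hnear := locally_between _ _ _ Hs).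
  assert (Hcomplete : is_derive (root_integral const1 opp_sin2 0 (PI / 2) n) s
    (- (1 / 2 + INR n) * root_integral const1 opp_sin2 0 (PI / 2) (S n) s)).
  { apply is_derive_root_integral;
      auto using continuity_const1, continuity_opp_sin2; [lra|].
    apply filter_imp with (2 := Hnear). intros u Hu x _.
    generalize (sin2_le_1 phi1) (elliptic_radicand_ge u x). lra. }
  assert (Hincomplete : is_derive (root_integral opp_sin2 const1 phi0 phi1 n) s
    (- (1 / 2 + INR n) * root_integral opp_sin2 const1 phi0 phi1 (S n) s)).
  { apply is_derive_root_integral;
      auto using continuity_const1, continuity_opp_sin2; [lra|].
    apply filter_imp with (2 := Hnear). intros u Hu x Hx.
    apply incomplete_radicand_gt_0 with phi1; lra. }
  unfold period.
  match goal with |- is_derive _ _ ?d => replace d with (/ sqrt 2 *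
    (2 * (- (1 / 2 + INR n) * root_integral const1 opp_sin2 0 (PI / 2) (S n) s)
     + - (1 / 2 + INR n) * root_integral opp_sin2 const1 phi0 phi1 (S n) s)) by ring end.
  apply is_derive_scal. apply (is_derive_plus (V := R_NormedModule)); [|exact Hincomplete].
  now apply is_derive_scal.
Qed.

Lemma root_integral_gt_0 p q a b n s :
  a < b -> continuity p -> continuity q ->
  (forall x, a <= x <= b -> 0 < p x + q x * s) ->
  (forall x, a < x < b -> 0 < q x ^ n) ->
  0 < root_integral p q a b n s.
Proof.
  intros Hab Hp Hq Hpos Hqn. apply RInt_gt_0; [assumption| |].
  - intros x Hx. unfold root_kernel. assert (Hu : 0 < p x + q x * s) by (apply Hpos; lra).
    apply Rdiv_lt_0_compat; [now apply Hqn|].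
    apply Rmult_lt_0_compat; [now apply sqrt_lt_R0 | now apply pow_lt].
  - intros x Hx. apply continuous_root_kernel; auto.
Qed.

Lemma inv_sqrt2_gt_0 : 0 < / sqrt 2.
Proof. apply Rinv_0_lt_compat, sqrt_lt_R0. lra. Qed.

Lemma period_2_gt_0 phi0 phi1 s :
  0 <= phi0 < phi1 -> phi1 < PI / 2 -> sin phi1 ^ 2 < s < 1 ->
  0 < period phi0 phi1 2 s.
Proof.
  intros H0 H1 Hs. assert (Hs1 := sin2_le_1 phi1).
  apply Rmult_lt_0_compat; [apply inv_sqrt2_gt_0|].
  apply Rplus_lt_0_compat; [apply Rmult_lt_0_compat; [lra|]|];
    apply root_integral_gt_0; auto using continuity_const1, continuity_opp_sin2; try lra.
  - intros x _. generalize (elliptic_radicand_ge s x). lra.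
  - intros x Hx. unfold opp_sin2.
    assert (0 < sin x) by (apply sin_gt_0; lra).
    replace ((- sin x ^ 2) ^ 2) with (sin x ^ 4) by ring. now apply pow_lt.
  - intros x Hx. apply incomplete_radicand_gt_0 with phi1; lra.
  - intros x _. unfold const1. lra.
Qed.

(** * Behaviour at the two ends of the interval *)

(** The comparison function [1 / (d + (b - x))] has integral
    [ln (d + (b - a)) - ln d], which is unbounded as [d] tends to 0. *)
Lemma RInt_log_lower (f : R -> R) (a b d : R) :
  a < b -> 0 < d -> ex_RInt f a b ->
  (forall x, a < x < b -> / (d + (b - x)) <= f x) ->
  ln (b - a) - ln d <= RInt f a b.
Proof.
  intros Hab Hd Hex Hf.
  assert (HI : is_RInt (fun x => / (d + (b - x))) a b
                 (minus (- ln (d + (b - b))) (- ln (d + (b - a))))).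
  { apply (is_RInt_derive (V := R_CompleteNormedModule) (fun x => - ln (d + (b - x))));
      rewrite Rmin_left, Rmax_right by lra; intros x Hx.
    - auto_derive; [lra|]. field. lra.
    - apply (ex_derive_continuous (V := R_NormedModule)). auto_derive. lra. }
  transitivity (RInt (fun x => / (d + (b - x))) a b).
  - rewrite (is_RInt_unique _ _ _ _ HI). unfold minus, plus, opp; simpl.
    rewrite Rminus_diag, Rplus_0_r.
    generalize (ln_le (b - a) (d + (b - a))). lra.
  - apply RInt_le; [lra | eexists; exact HI | exact Hex | exact Hf].
Qed.

(** With [d = sqrt (1 - s)] and [cos x <= PI/2 - x], the radicand satisfies
    [1 - s sin^2 x = d^2 + s cos^2 x <= d^2 + (PI/2 - x)^2 <= (d + (PI/2 - x))^2]. *)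
Lemma elliptic_log_lower s :
  0 < s < 1 -> ln (PI / 2) - / 2 * ln (1 - s) <= elliptic s (PI / 2).
Proof.
  intros Hs. assert (HPI := PI_RGT_0).
  assert (Hd : 0 < sqrt (1 - s)) by (apply sqrt_lt_R0; lra).
  assert (Hdd : sqrt (1 - s) * sqrt (1 - s) = 1 - s) by (apply sqrt_sqrt; lra).
  replace (/ 2 * ln (1 - s)) with (ln (sqrt (1 - s))).
  2:{ rewrite <- Hdd at 2. rewrite ln_mult by assumption. field. }
  replace (PI / 2) with (PI / 2 - 0) at 1 by ring.
  apply RInt_log_lower; [lra | assumption | |].
  - apply ex_RInt_root_kernel; auto using continuity_const1, continuity_opp_sin2; [lra|].
    intros x _. generalize (elliptic_radicand_ge s x). lra.
  - intros x Hx. unfold root_kernel; simpl pow. unfold Rdiv at 2.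
    rewrite Rmult_1_l, Rmult_1_r.
    assert (Hpos := elliptic_radicand_ge s x ltac:(lra)).
    apply Rinv_le_contravar; [apply sqrt_lt_R0; lra|].
    apply Rsqr_incr_0_var; [|lra]. rewrite Rsqr_sqrt by lra.
    assert (Hc : cos x < PI / 2 - x) by (rewrite <- sin_shift; apply sin_lt_x; lra).
    assert (Hc0 : 0 < cos x) by (apply cos_gt_0; lra).
    generalize (sin2_cos2 x). unfold Rsqr, const1, opp_sin2. intros E.
    assert (0 < sqrt (1 - s) * (PI / 2 - x)) by (apply Rmult_lt_0_compat; lra).
    assert (s * (cos x * cos x) <= cos x * cos x) by nra.
    assert (cos x * cos x <= (PI / 2 - x) * (PI / 2 - x)) by nra.
    nra.
Qed.

(** By [sin^2 y - sin^2 x = sin (y - x) sin (y + x)]. *)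
Lemma sin2_sub_le x y : 0 <= x <= y -> y <= PI / 2 -> sin y ^ 2 - sin x ^ 2 <= y - x.
Proof.
  intros Hx Hy.
  replace (sin y ^ 2 - sin x ^ 2) with (sin (y - x) * sin (y + x)).
  2:{ rewrite sin_minus, sin_plus. generalize (sin2_cos2 x) (sin2_cos2 y).
      unfold Rsqr. intros E1 E2.
      transitivity (sin y * sin y * (cos x * cos x) - cos y * cos y * (sin x * sin x)); [ring|].
      replace (cos x * cos x) with (1 - sin x * sin x) by lra.
      replace (cos y * cos y) with (1 - sin y * sin y) by lra. ring. }
  assert (H0 : 0 <= sin (y - x) <= y - x).
  { split; [apply sin_ge_0; lra|].
    destruct (Req_dec x y) as [->|Hne]; [rewrite Rminus_diag, sin_0; lra|].
    apply Rlt_le, sin_lt_x. lra. }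
  generalize (SIN_bound (y + x)). nra.
Qed.

(** The true rate is [(s - sin^2 phi1)^(-1/2)], but a logarithm suffices: the
    quantity [u = s - sin^2 x] is at most 1, so [u^(-3/2)] is at least [1 / u],
    and [u] is at most [(s - sin^2 phi1) + (phi1 - x)]. *)
Lemma incomplete_log_lower phi0 phi1 s :
  0 <= phi0 < phi1 -> phi1 < PI / 2 -> sin phi1 ^ 2 < s < 1 ->
  ln (phi1 - phi0) - ln (s - sin phi1 ^ 2) <= root_integral opp_sin2 const1 phi0 phi1 1 s.
Proof.
  intros H0 H1 Hs.
  assert (Hpos : forall x, phi0 <= x <= phi1 -> 0 < opp_sin2 x + const1 x * s).
  { intros x Hx. apply incomplete_radicand_gt_0 with phi1; lra. }
  apply RInt_log_lower; [lra | lra | |].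
  - apply ex_RInt_root_kernel; auto using continuity_const1, continuity_opp_sin2. lra.
  - intros x Hx. unfold root_kernel. specialize (Hpos x ltac:(lra)).
    assert (Hle : opp_sin2 x + const1 x * s <= s - sin phi1 ^ 2 + (phi1 - x)).
    { unfold opp_sin2, const1. generalize (sin2_sub_le x phi1). lra. }
    assert (H1' : opp_sin2 x + const1 x * s <= 1).
    { unfold opp_sin2, const1. generalize (sin2_le_1 x). lra. }
    replace (const1 x ^ 1) with 1 by (unfold const1; ring). rewrite pow_1.
    unfold Rdiv. rewrite Rmult_1_l.
    assert (Hr := sqrt_lt_R0 _ Hpos).
    assert (Hr1 : sqrt (opp_sin2 x + const1 x * s) <= 1).
    { rewrite <- sqrt_1. now apply sqrt_le_1_alt. }
    apply Rinv_le_contravar; [now apply Rmult_lt_0_compat|].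
    transitivity (1 * (opp_sin2 x + const1 x * s)); [|lra].
    apply Rmult_le_compat_r; lra.
Qed.

Lemma filterlim_p_infty_lower {U : Type} (F : (U -> Prop) -> Prop) {FF : Filter F}
  (f g : U -> R) (A k : R) :
  0 < k -> filterlim f F (Rbar_locally m_infty) ->
  F (fun u => A - k * f u <= g u) -> filterlim g F (Rbar_locally p_infty).
Proof.
  intros Hk Hf Hg P [M HM].
  assert (Hfar : F (fun u => f u < (A - M) / k)).
  { apply (Hf (fun x => x < (A - M) / k)). exists ((A - M) / k). auto. }
  change (F (fun u => P (g u))).
  generalize (filter_and _ _ Hfar Hg). apply filter_imp. intros u [H1 H2].
  apply HM. apply Rlt_div_r in H1; [|assumption]. lra.
Qed.

Lemma filterlim_ln_at_left_1 :
  filterlim (fun s => ln (1 - s)) (at_left 1) (Rbar_locally m_infty).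
Proof.
  apply (filterlim_comp R R R (fun s => 1 - s) ln _ (at_right 0)); [|exact is_lim_ln_0].
  intros P [d Hd]. exists d. intros s Hs Hs1. apply Hd; [|lra].
  apply Rabs_def2 in Hs. apply Rabs_def1;
    unfold minus, plus, opp in *; simpl in *; lra.
Qed.

Lemma filterlim_ln_at_right a :
  filterlim (fun s => ln (s - a)) (at_right a) (Rbar_locally m_infty).
Proof.
  apply (filterlim_comp R R R (fun s => s - a) ln _ (at_right 0)); [|exact is_lim_ln_0].
  intros P [d Hd]. exists d. intros s Hs Hs1. apply Hd; [|lra].
  apply Rabs_def2 in Hs. apply Rabs_def1;
    unfold minus, plus, opp in *; simpl in *; lra.
Qed.

Lemma sin2_lt_1 x : 0 <= x < PI / 2 -> sin x ^ 2 < 1.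
Proof.
  intros Hx. replace 1 with (sin (PI / 2) ^ 2) by (rewrite sin_PI2; ring).
  apply sin2_lt; lra.
Qed.

Lemma filterlim_period_at_left_1 phi0 phi1 :
  0 <= phi0 < phi1 -> phi1 < PI / 2 ->
  filterlim (period phi0 phi1 0) (at_left 1) (Rbar_locally p_infty).
Proof.
  intros H0 H1. assert (Hs1 := sin2_lt_1 phi1 ltac:(lra)). assert (Hs0 := sin2_le_1 phi1).
  apply (filterlim_p_infty_lower (at_left 1)) with (1 := inv_sqrt2_gt_0)
    (2 := filterlim_ln_at_left_1) (A := / sqrt 2 * (2 * ln (PI / 2))).
  apply filter_imp with (2 := at_left_interval _ _ Hs1). intros s Hs.
  assert (Hlow := elliptic_log_lower s ltac:(lra)). unfold elliptic in Hlow.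
  assert (Hpos : 0 < root_integral opp_sin2 const1 phi0 phi1 0 s).
  { apply root_integral_gt_0; auto using continuity_const1, continuity_opp_sin2; [lra| |].
    - intros x Hx. apply incomplete_radicand_gt_0 with phi1; lra.
    - intros x _. simpl. lra. }
  rewrite <- Rmult_minus_distr_l.
  apply Rmult_le_compat_l; [apply Rlt_le, inv_sqrt2_gt_0|]. lra.
Qed.

(** The complete integral is differentiable at [sin^2 phi1], so its contribution
    stays bounded and cannot compensate the divergence of the other one. *)
Lemma filterlim_period_1_at_right phi0 phi1 :
  0 <= phi0 < phi1 -> phi1 < PI / 2 ->
  filterlim (period phi0 phi1 1) (at_right (sin phi1 ^ 2)) (Rbar_locally p_infty).
Proof.
  intros H0 H1. assert (Hs1 := sin2_lt_1 phi1 ltac:(lra)).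
  assert (Hs0 : 0 < sin phi1 ^ 2) by (apply pow_lt, sin_gt_0; lra).
  set (s1 := sin phi1 ^ 2) in *.
  set (A := root_integral const1 opp_sin2 0 (PI / 2) 1).
  assert (HA : at_right s1 (fun s => A s1 - 1 < A s)).
  { apply filter_le_within. 
    assert (HcA : continuous A s1).
    { apply (ex_derive_continuous (V := R_NormedModule)). eexists.
      apply is_derive_root_integral; auto using continuity_const1, continuity_opp_sin2; [lra|].
      apply filter_imp with (2 := locally_between 0 1 s1 (conj Hs0 Hs1)).
      intros u Hu x _. generalize (elliptic_radicand_ge u x). lra. }
    apply (HcA (fun y => A s1 - 1 < y)). apply open_gt. lra. }
  apply (filterlim_p_infty_lower (at_right s1)) with (1 := inv_sqrt2_gt_0)
    (2 := filterlim_ln_at_right s1)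
    (A := / sqrt 2 * (2 * (A s1 - 1) + ln (phi1 - phi0))).
  generalize (filter_and _ _ HA (at_right_interval _ _ Hs1)). apply filter_imp.
  intros s [HAs Hs].
  assert (Hlow := incomplete_log_lower phi0 phi1 s H0 H1 Hs). fold s1 in Hlow.
  rewrite <- Rmult_minus_distr_l.
  apply Rmult_le_compat_l; [apply Rlt_le, inv_sqrt2_gt_0|]. fold A. lra.
Qed.

(** Splitting the integral over [phi0, phi1] as the integral over [0, phi1] minus
    that over [0, phi0] makes the singular part an incomplete elliptic integral;
    the other part is continuous at [sin^2 phi1], because [phi0 < phi1]. *)
Lemma filterlim_period_at_right phi0 phi1 :
  0 < phi0 < phi1 -> phi1 < PI / 2 ->
  filterlim (period phi0 phi1 0) (at_right (sin phi1 ^ 2)) (locally (Tstar phi0 phi1)).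
Proof.
  intros H0 H1. assert (Hs1 := sin2_lt_1 phi1 ltac:(lra)).
  assert (Hsin : 0 < sin phi1) by (apply sin_gt_0; lra).
  assert (Hs0 : 0 < sin phi1 ^ 2) by now apply pow_lt.
  unfold Tstar. rewrite T_eq, T1_eq by lra.
  set (s1 := sin phi1 ^ 2) in *.
  set (B := root_integral opp_sin2 const1 0 phi0 0).
  assert (Hid : filterlim (fun s => s) (at_right s1) (locally s1)).
  { intros P HP. now apply filter_le_within. }
  assert (Hloc : forall f : R -> R, continuous f s1 -> filterlim f (at_right s1) (locally (f s1))).
  { intros f Hf. now apply continuous_within. }
  replace (3 * (/ sqrt 2 * elliptic s1 (PI / 2)) - / sqrt 2 * B s1)
    with (/ sqrt 2 * (2 * elliptic s1 (PI / 2) + (elliptic s1 (PI / 2) + - 1 * B s1))) by ring.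
  apply filterlim_ext_loc with (fun s => / sqrt 2 * (2 * elliptic s (PI / 2)
    + (elliptic s (asin (sin phi1 / sqrt s)) + - 1 * B s))).
  { apply filter_imp with (2 := at_right_interval _ _ Hs1). intros s Hs.
    rewrite <- incomplete_eq_elliptic by (fold s1; lra).
    rewrite <- (incomplete_Chasles phi0 phi1) by (fold s1; lra).
    unfold period, elliptic, B. ring. }
  assert (HK : filterlim (fun s => elliptic s (PI / 2)) (at_right s1) (locally (elliptic s1 (PI / 2)))).
  { apply (Hloc (fun s => elliptic s (PI / 2))). apply continuous_complete_elliptic. lra. }
  apply (filterlim_Rmult (at_right s1)); [apply filterlim_const|].
  apply (filterlim_Rplus (at_right s1)).
  { apply (filterlim_Rmult (at_right s1)); [apply filterlim_const | exact HK]. }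
  apply (filterlim_Rplus (at_right s1)).
  - apply (filterlim_elliptic_asin (at_right s1) (fun s => s) (fun s => sin phi1 / sqrt s)).
    + lra.
    + exact Hid.
    + assert (Hr : sqrt s1 = sin phi1) by (apply sqrt_pow2; lra).
      replace 1 with (sin phi1 / sqrt s1) by (rewrite Hr; field; lra).
      apply (Hloc (fun s => sin phi1 / sqrt s)).
      apply (ex_derive_continuous (V := R_NormedModule) (fun s => sin phi1 / sqrt s)).
      auto_derive. rewrite Hr. repeat split; lra.
    + apply filter_imp with (2 := at_right_interval _ _ Hs1). intros s Hs.
      assert (Hrs : sin phi1 < sqrt s).
      { rewrite <- (sqrt_pow2 (sin phi1)) by lra. apply sqrt_lt_1_alt. fold s1. lra. }
      split; [apply Rdiv_lt_0_compat; lra|]. apply Rlt_div_l; lra.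
  - apply (filterlim_Rmult (at_right s1)); [apply filterlim_const|].
    apply (Hloc B). apply (ex_derive_continuous (V := R_NormedModule)). eexists.
    apply is_derive_root_integral; auto using continuity_const1, continuity_opp_sin2; [lra|].
    assert (Hlt : sin phi0 ^ 2 < s1) by (apply sin2_lt; lra).
    apply filter_imp with (2 := open_gt _ _ Hlt). intros u Hu x Hx.
    apply incomplete_radicand_gt_0 with phi0; lra.
Qed.

(** * Convex functions of one variable *)

Lemma derive_increasing (f1 f2 : R -> R) (a b : R) :
  (forall x, a < x < b -> is_derive f1 x (f2 x)) ->
  (forall x, a < x < b -> 0 < f2 x) ->
  forall x y, a < x -> x < y -> y < b -> f1 x < f1 y.
Proof.
  intros H1 H2. apply (incr_function f1 a b f2); simpl; intros x Hxa Hxb.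
  - now apply H1.
  - now apply H2.
Qed.

Lemma convex_on_derive_increasing (f f1 : R -> R) (a b : R) :
  (forall x, a < x < b -> is_derive f x (f1 x)) ->
  (forall x y, a < x -> x < y -> y < b -> f1 x < f1 y) ->
  convex_on a b f.
Proof.
  intros Hf Hincr.
  assert (Hle : forall x y t, a < x -> x <= y -> y < b -> 0 <= t <= 1 ->
            f (t * x + (1 - t) * y) <= t * f x + (1 - t) * f y).
  { intros x y t Hx Hxy Hy Ht. set (z := t * x + (1 - t) * y).
    assert (Hz : x <= z <= y) by (unfold z; nra).
    destruct (MVT_gen f x z f1) as [c1 [Hc1 E1]];
      [| |destruct (MVT_gen f z y f1) as [c2 [Hc2 E2]]].
    1-4: rewrite Rmin_left, Rmax_right by lra; intros u Hu.
    1,3: apply Hf; lra.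
    1,2: apply derivable_continuous_pt; exists (f1 u); apply is_derive_Reals, Hf; lra.
    rewrite Rmin_left, Rmax_right in Hc1, Hc2 by lra.
    assert (H12 : f1 c1 <= f1 c2).
    { destruct (Req_dec c1 c2) as [->|Hne]; [lra|]. apply Rlt_le, Hincr; lra. }
    (* The convexity defect factors through the slopes on [x, z] and [z, y]. *)
    assert (Hgap : t * f x + (1 - t) * f y - f z = t * (1 - t) * (y - x) * (f1 c2 - f1 c1)).
    { replace (f y) with (f z + f1 c2 * (y - z)) by lra.
      replace (f x) with (f z - f1 c1 * (z - x)) by lra. unfold z. ring. }
    assert (0 <= t * (1 - t) * (y - x) * (f1 c2 - f1 c1)).
    { repeat apply Rmult_le_pos; lra. }
    lra. }
  intros x y t Hx Hy Ht. destruct (Rle_lt_dec x y) as [Hxy|Hxy].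
  - apply Hle; lra.
  - replace (t * x + (1 - t) * y) with ((1 - t) * y + (1 - (1 - t)) * x) by ring.
    generalize (Hle y x (1 - t)). lra.
Qed.

(** The slope [f1] is negative near [a].  It is positive somewhere, since
    otherwise [f] could not rise to plus infinity at [b]; being continuous and
    strictly increasing, it vanishes exactly once. *)
Lemma valley_point (f f1 f2 : R -> R) (a b : R) :
  a < b ->
  (forall x, a < x < b -> is_derive f x (f1 x)) ->
  (forall x, a < x < b -> is_derive f1 x (f2 x)) ->
  (forall x, a < x < b -> 0 < f2 x) ->
  filterlim f (at_left b) (Rbar_locally p_infty) ->
  filterlim f1 (at_right a) (Rbar_locally m_infty) ->
  exists c, a < c < b /\
    (forall x, a < x < c -> f1 x < 0) /\ f1 c = 0 /\ (forall x, c < x < b -> 0 < f1 x).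
Proof.
  intros Hab Hf Hf1 Hpos Hlim Hlim1.
  assert (Hincr := derive_increasing f1 f2 a b Hf1 Hpos).
  assert (Hneg : exists d, a < d < b /\ f1 d < 0).
  { assert (Hev : at_right a (fun x => f1 x < 0)).
    { apply (Hlim1 (fun y => y < 0)). now exists 0. }
    destruct (filter_ex _ (filter_and _ _ Hev (at_right_interval a b Hab))) as [d [H1 H2]].
    now exists d. }
  destruct Hneg as [d [Hd Hfd]].
  assert (Hup : exists e, d < e < b /\ 0 < f1 e).
  { assert (Hev : at_left b (fun x => f d < f x)).
    { apply (Hlim (fun y => f d < y)). now exists (f d). }
    destruct (filter_ex _ (filter_and _ _ Hev (at_left_interval d b (proj2 Hd)))) as [e [H1 H2]].
    destruct (MVT_gen f d e f1) as [u [Hu E]].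
    1,2: rewrite Rmin_left, Rmax_right by lra; intros u Hu.
    1: apply Hf; lra.
    1: apply derivable_continuous_pt; exists (f1 u); apply is_derive_Reals, Hf; lra.
    rewrite Rmin_left, Rmax_right in Hu by lra.
    assert (0 < f1 u) by nra.
    exists u. split; [|assumption]. split; [|lra].
    destruct (Req_dec d u) as [<-|Hne]; lra. }
  destruct Hup as [e [He Hfe]].
  destruct (IVT_interv f1 d e) as [c [Hc Hfc]]; try lra.
  { intros u Hu. apply derivable_continuous_pt. exists (f2 u).
    apply is_derive_Reals, Hf1. lra. }
  exists c. split; [lra|]. split; [|split; [assumption|]]; intros x Hx.
  - rewrite <- Hfc. apply Hincr; lra.
  - rewrite <- Hfc. apply Hincr; lra.
Qed.

Lemma locally_contains_interval (P : R -> Prop) (x : R) :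
  locally x P -> exists a b, a < x < b /\ forall y, a < y < b -> P y.
Proof.
  intros [d Hd]. exists (x - d), (x + d). assert (0 < d) by apply d.
  split; [lra|]. intros y Hy. apply Hd. apply Rabs_def1;
    unfold minus, plus, opp; simpl; lra.
Qed.

(** Fermat's theorem for the two kinds of local extremum. *)
Lemma is_derive_local_extremum (f : R -> R) (x l : R) :
  is_derive f x l -> local_extremum f x -> l = 0.
Proof.
  intros Hf Hext. apply is_derive_Reals in Hf.
  set (pr := exist _ l Hf : derivable_pt f x).
  change l with (derive_pt f x pr).
  destruct Hext as [Hm|Hm]; destruct (locally_contains_interval _ _ Hm) as [a [b [Hx Hab]]].
  - apply (deriv_minimum f a b); try lra. intros y Hy1 Hy2. now apply Hab.
  - apply (deriv_maximum f a b); try lra. intros y Hy1 Hy2. now apply Hab.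
Qed.

(** * The theorem *)

Theorem mainTheorem4 (phi0 phi1 : R) (Tt : R -> R)
  (hphi0 : 0 < phi0) (hphi01 : phi0 < phi1) (hphi1 : phi1 < PI / 2)
  (hTt : forall alpha : R, phi1 < alpha < PI / 2 ->
     Tt ((sin alpha) ^ 2) = TC phi0 phi1 alpha) :
  ((forall s : R, (sin phi1) ^ 2 < s < 1 ->
      ex_derive Tt s /\ ex_derive (Derive Tt) s /\ 0 < Derive (Derive Tt) s) /\
   convex_on ((sin phi1) ^ 2) 1 Tt)
  /\
  (filterlim Tt (at_left 1) (Rbar_locally p_infty) /\
   filterlim Tt (at_right ((sin phi1) ^ 2)) (locally (Tstar phi0 phi1)) /\
   filterlim (Derive Tt) (at_right ((sin phi1) ^ 2)) (Rbar_locally m_infty))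
  /\
  ((exists alpha : R,
      unique (fun a : R => phi1 < a < PI / 2 /\
                           local_extremum (TC phi0 phi1) a) alpha /\
      local_min (TC phi0 phi1) alpha) /\
   at_right phi1 (fun alpha : R => TC phi0 phi1 alpha < Tstar phi0 phi1)).
Proof.
  assert (Hphi : 0 <= phi0 < phi1) by lra.
  assert (Hs1 := sin2_lt_1 phi1 ltac:(lra)).
  assert (Hs0 : 0 < sin phi1 ^ 2) by (apply pow_lt, sin_gt_0; lra).
  set (s1 := sin phi1 ^ 2) in *.
  (* The change of variable [s = sin^2 alpha] is onto the interval of [s]. *)
  assert (Hangle : forall s, s1 < s < 1 ->
            phi1 < asin (sqrt s) < PI / 2 /\ sin (asin (sqrt s)) ^ 2 = s).
  { intros s Hs.
    assert (Hr1 : sin phi1 < sqrt s).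
    { rewrite <- (sqrt_pow2 (sin phi1)) by (apply sin_ge_0; lra). apply sqrt_lt_1_alt. fold s1. lra. }
    assert (Hr2 : sqrt s < 1) by (rewrite <- sqrt_1; apply sqrt_lt_1_alt; lra).
    assert (Hr0 : 0 <= sqrt s) by apply sqrt_pos.
    assert (Hb := asin_bound_lt (sqrt s) ltac:(lra)).
    rewrite sin_asin by lra. split.
    - split; [|lra]. apply sin_increasing_0; try lra. rewrite sin_asin; lra.
    - apply pow2_sqrt. lra. }
  assert (Hsin2 : forall alpha, phi1 < alpha < PI / 2 -> s1 < sin alpha ^ 2 < 1).
  { intros alpha Ha. split; [apply sin2_lt | apply sin2_lt_1]; lra. }
  assert (HTt_eq : forall s, s1 < s < 1 -> Tt s = period phi0 phi1 0 s).
  { intros s Hs. destruct (Hangle s Hs) as [Ha E].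
    rewrite <- E at 1. rewrite hTt, TC_eq_period, E by lra. reflexivity. }
  set (f1 := fun s => - / 2 * period phi0 phi1 1 s).
  set (f2 := fun s => 3 / 4 * period phi0 phi1 2 s).
  assert (Hd1 : forall s, s1 < s < 1 -> is_derive Tt s (f1 s)).
  { intros s Hs. apply is_derive_ext_loc with (period phi0 phi1 0).
    - apply filter_imp with (2 := locally_between _ _ _ Hs).
      intros u Hu. symmetry. now apply HTt_eq.
    - replace (f1 s) with (- (1 / 2 + INR 0) * period phi0 phi1 1 s)
        by (unfold f1; simpl; field).
      apply is_derive_period; [lra | lra | exact Hs]. }
  assert (Hd2 : forall s, s1 < s < 1 -> is_derive f1 s (f2 s)).
  { intros s Hs. replace (f2 s) with (- / 2 * (- (1 / 2 + INR 1) * period phi0 phi1 2 s))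
      by (unfold f2; simpl; field).
    apply is_derive_scal. apply is_derive_period; [lra | lra | exact Hs]. }
  assert (Hf2 : forall s, s1 < s < 1 -> 0 < f2 s).
  { intros s Hs. apply Rmult_lt_0_compat; [lra|].
    apply period_2_gt_0; [lra | lra | exact Hs]. }
  assert (HD1 : forall s, s1 < s < 1 -> Derive Tt s = f1 s).
  { intros s Hs. now apply is_derive_unique, Hd1. }
  assert (HD2 : forall s, s1 < s < 1 -> is_derive (Derive Tt) s (f2 s)).
  { intros s Hs. apply is_derive_ext_loc with f1; [|now apply Hd2].
    apply filter_imp with (2 := locally_between _ _ _ Hs).
    intros u Hu. symmetry. now apply HD1. }
  assert (Hincr := derive_increasing f1 f2 s1 1 Hd2 Hf2).
  assert (Hinfty : filterlim Tt (at_left 1) (Rbar_locally p_infty)).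
  { apply filterlim_ext_loc with (period phi0 phi1 0).
    - apply filter_imp with (2 := at_left_interval _ _ Hs1).
      intros s Hs. symmetry. now apply HTt_eq.
    - now apply filterlim_period_at_left_1. }
  assert (Hstar : filterlim Tt (at_right s1) (locally (Tstar phi0 phi1))).
  { apply filterlim_ext_loc with (period phi0 phi1 0).
    - apply filter_imp with (2 := at_right_interval _ _ Hs1).
      intros s Hs. symmetry. now apply HTt_eq.
    - apply filterlim_period_at_right; lra. }
  assert (Hslope : filterlim f1 (at_right s1) (Rbar_locally m_infty)).
  { intros P [M HM].
    assert (Hlim := filterlim_period_1_at_right phi0 phi1 Hphi hphi1).
    assert (Hev : at_right s1 (fun s => - 2 * M < period phi0 phi1 1 s)).
    { apply (Hlim (fun y => - 2 * M < y)). now exists (- 2 * M). }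
    change (at_right s1 (fun s => P (f1 s))).
    apply filter_imp with (2 := Hev). intros s Hs. apply HM. unfold f1. lra. }
  (* [c] is the critical parameter; the critical angle is [asin (sqrt c)]. *)
  destruct (valley_point Tt f1 f2 s1 1 Hs1 Hd1 Hd2 Hf2 Hinfty Hslope)
    as [c [Hc [Hleft [Hcrit Hright]]]].
  assert (Hdecr : forall x y, s1 < x -> x < y -> y < c -> Tt y < Tt x).
  { intros x y Hx Hxy Hy.
    assert (- Tt x < - Tt y); [|lra].
    apply (derive_increasing (fun s => - Tt s) (fun s => - f1 s) s1 c); try assumption.
    - intros s Hs. apply (is_derive_opp (V := R_NormedModule)), Hd1. lra.
    - intros s Hs. specialize (Hleft s Hs). lra. }
  assert (Hmin : forall s, s1 < s < 1 -> Tt c <= Tt s).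
  { intros s Hs.
    destruct (MVT_gen Tt c s f1) as [u [Hu E]].
    - intros x Hx. apply Hd1. destruct (Rle_lt_dec c s).
      + rewrite Rmin_left, Rmax_right in Hx; lra.
      + rewrite Rmin_right, Rmax_left in Hx; lra.
    - intros x Hx. apply derivable_continuous_pt. exists (f1 x).
      apply is_derive_Reals, Hd1. destruct (Rle_lt_dec c s).
      + rewrite Rmin_left, Rmax_right in Hx; lra.
      + rewrite Rmin_right, Rmax_left in Hx; lra.
    - destruct (Rle_lt_dec c s).
      + rewrite Rmin_left, Rmax_right in Hu by lra.
        assert (0 <= f1 u).
        { destruct (Req_dec u c) as [->|Hne]; [lra|]. apply Rlt_le, Hright. lra. }
        nra.
      + rewrite Rmin_right, Rmax_left in Hu by lra.
        assert (f1 u <= 0).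
        { destruct (Req_dec u c) as [->|Hne]; [lra|]. apply Rlt_le, Hleft. lra. }
        nra. }
  destruct (Hangle c Hc) as [Hac Ec]. set (ac := asin (sqrt c)) in *.
  assert (HTCmin : local_min (TC phi0 phi1) ac).
  { apply filter_imp with (2 := locally_between _ _ _ Hac). intros a Ha.
    rewrite <- !hTt, Ec by assumption. apply Hmin. now apply Hsin2. }
  split; [split|split; [split; [|split]|split]].
  - intros s Hs. split; [|split].
    + eexists. now apply Hd1.
    + eexists. now apply HD2.
    + rewrite (is_derive_unique _ _ _ (HD2 s Hs)). now apply Hf2.
  - now apply convex_on_derive_increasing with f1.
  - exact Hinfty.
  - exact Hstar.
  - apply filterlim_ext_loc with f1; [|exact Hslope].
    apply filter_imp with (2 := at_right_interval _ _ Hs1).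
    intros s Hs. symmetry. now apply HD1.
  - exists ac. split; [|exact HTCmin]. split; [split; [exact Hac | now left]|].
    intros a [Ha Hext].
    assert (Hsa := Hsin2 a Ha).
    assert (Hder : is_derive (TC phi0 phi1) a (2 * sin a * cos a * f1 (sin a ^ 2))).
    { apply is_derive_ext_loc with (fun x => Tt (sin x ^ 2)).
      - apply filter_imp with (2 := locally_between _ _ _ Ha). exact hTt.
      - apply (is_derive_comp Tt (fun x => sin x ^ 2)); [now apply Hd1|].
        auto_derive; [exact I|]. ring. }
    assert (Hzero := is_derive_local_extremum _ _ _ Hder Hext).
    assert (Hsp : 0 < sin a) by (apply sin_gt_0; lra).
    assert (Hcp : 0 < cos a) by (apply cos_gt_0; lra).
    assert (Hf0 : f1 (sin a ^ 2) = 0).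
    { apply Rmult_integral in Hzero. destruct Hzero as [Hz|Hz]; [|exact Hz].
      assert (0 < 2 * sin a * cos a) by (repeat apply Rmult_lt_0_compat; lra). lra. }
    assert (Hsc : sin a ^ 2 = c).
    { destruct (Rtotal_order (sin a ^ 2) c) as [Hlt|[Heq|Hgt]]; [|exact Heq|].
      - specialize (Hleft (sin a ^ 2)). lra.
      - specialize (Hright (sin a ^ 2)). lra. }
    unfold ac. rewrite <- Hsc, sqrt_pow2 by lra. apply asin_sin. lra.
  - apply filter_imp with (2 := at_right_interval _ _ (proj1 Hac)). intros a Ha.
    assert (Ha' : phi1 < a < PI / 2) by lra.
    assert (Hsa := Hsin2 a Ha').
    assert (Hsac : sin a ^ 2 < c) by (rewrite <- Ec; apply sin2_lt; lra).
    rewrite <- hTt by assumption.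
    (* The midpoint [m] makes the inequality strict: [Tt s < Tt m], and [Tt m] is a
       lower bound of [Tt] to its left, hence of the limit [Tstar]. *)
    set (s := sin a ^ 2) in *. set (m := (s1 + s) / 2).
    apply Rlt_le_trans with (Tt m); [apply Hdecr; unfold m; lra|].
    assert (Hm : s1 < m) by (unfold m; lra).
    apply (filterlim_le (F := at_right s1) (fun _ => Tt m) Tt (Tt m) (Tstar phi0 phi1));
      [|apply filterlim_const | exact Hstar].
    apply filter_imp with (2 := at_right_interval _ _ Hm). intros u Hu.
    apply Rlt_le, Hdecr; unfold m in *; lra.
Qed.
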